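(* For every positive integer $n$, the sets $\mathcal A_n$ and $\mathcal B_n$ are in bijection.
   Context: $\mathcal A_n$ denotes the set of triples $(A,s,i)$ where $A$ is a rooted planar (i.e. ordered, plane) tree with $n$ vertices, $s$ is a vertex of $A$ different from its root, and $i$ is an integer with $1\le i\le 2p(s)-1$, where $p(s)$ is the depth of the vertex $s$ (its distance to the root). $\mathcal B_n$ denotes the set of couples $(B,r)$ where $B$ is a connected plane graph (embedded in the plane, considered up to orientation-preserving homeomorphism of the plane; multiple edges allowed) with $n$ vertices, having exactly one cycle, this cycle being of even length, and $r$ is a vertex of $B$. Equivalently, an element of $\mathcal B_n$ is given by a planar cycle of length $2\ell$ for some $\ell\ge 1$ (for $\ell=1$, a double edge), with $4\ell$ rooted plane trees attached (at each vertex of the cycle, one in the inner face and one in the outer face, each possibly reduced to its root, the roots being identified with the cycle vertex), with $n$ vertices in total, one of which is distinguished. *)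

(* Defs.v *)
From HB Require Import structures.
From mathcomp Require Import all_boot generic_quotient.

Set Implicit Arguments.
Unset Strict Implicit.
Unset Printing Implicit Defensive.

Inductive tree : Type := Node of seq tree.

Definition children (t : tree) : seq tree := let: Node ts := t in ts.

Lemma tree_ind_all (P : tree -> Prop) :
  (forall ts, foldr (fun t => and (P t)) True ts -> P (Node ts)) ->
  forall t, P t.
Proof.
move=> H; fix IH 1 => -[ts]; apply: H.
by elim: ts => [//|t ts IHts]; split; [exact: IH|exact: IHts].
Qed.

Fixpoint tree_encode (t : tree) : GenTree.tree unit :=
  let: Node ts := t in GenTree.Node 0 (map tree_encode ts).

Fixpoint tree_decode (g : GenTree.tree unit) : tree :=
  if g is GenTree.Node _ gs then Node (map tree_decode gs) else Node [::].

Lemma tree_encodeK : cancel tree_encode tree_decode.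
Proof.
elim/tree_ind_all => ts IH /=; congr Node.
by elim: ts IH => [//|t ts IHts] /= [-> /IHts ->].
Qed.

HB.instance Definition _ := Countable.copy tree (can_type tree_encodeK).

Fixpoint nb_vertices (t : tree) : nat :=
  let: Node ts := t in (sumn (map nb_vertices ts)).+1.

(* A vertex is represented by the sequence of child ranks (from 0) met on the
   path leading to it from the root; so [::] is the root, and the depth of a
   vertex is the length of its sequence. *)
Definition address := seq nat.

Fixpoint is_vertex (t : tree) (s : address) : bool :=
  if s is i :: s' then
    (i < size (children t)) && is_vertex (nth (Node [::]) (children t) i) s'
  else true.

Definition depth (s : address) : nat := size s.

Definition in_calA (n : nat) (x : tree * address * nat) : bool :=
  let: (A, s, i) := x in
  [&& nb_vertices A == n, is_vertex A s, s != [::] & 1 <= i <= 2 * depth s - 1].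

Definition calA (n : nat) : Type := {x : tree * address * nat | in_calA n x}.

(* A plane graph whose only cycle has length m is drawn from a sequence of
   length m: its k-th item is the pair (tree in the inner face, tree in the
   outer face) attached at the k-th vertex of the cycle, where the vertices of
   the cycle are numbered counterclockwise from an arbitrary one.  The roots of
   the two trees are both identified with the cycle vertex.  At that vertex the
   two cycle edges separate the inner edges from the outer ones, so the children
   of each root are linearly ordered. *)
Definition cyclic_drawing := seq (tree * tree).

(* The two roots identified with a cycle vertex count for one vertex. *)
Definition drawing_nb_vertices (w : cyclic_drawing) : nat :=
  \sum_(p <- w) (1 + (nb_vertices p.1).-1 + (nb_vertices p.2).-1).

(* (k, None) is the k-th vertex of the cycle; (k, Some (true, a)) and
   (k, Some (false, a)) are the non-root vertices of address a in, respectively,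
   the inner and the outer tree attached at the k-th vertex of the cycle. *)
Definition drawing_vertex := (nat * option (bool * address))%type.

Definition is_drawing_vertex (w : cyclic_drawing) (r : drawing_vertex) : bool :=
  (r.1 < size w) &&
  (if r.2 is Some (inner, a) then
     let p := nth (Node [::], Node [::]) w r.1 in
     (a != [::]) && is_vertex (if inner then p.1 else p.2) a
   else true).

Definition in_drawing (n : nat) (x : cyclic_drawing * drawing_vertex) : bool :=
  let: (w, r) := x in
  [&& 0 < size w, ~~ odd (size w), drawing_nb_vertices w == n
    & is_drawing_vertex w r].

Definition drawing (n : nat) : Type :=
  {x : cyclic_drawing * drawing_vertex | in_drawing n x}.

HB.instance Definition _ n := Choice.on (drawing n).

(* Two drawings represent the same pair (B, r) up to orientation-preserving
   homeomorphism of the plane iff they differ by the choice of the cycle vertex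
   numbered 0: a homeomorphism exchanges neither the two faces nor the two
   directions of the cycle.  The k-th item of rot j w is the item of w of rank
   k + j modulo the size of w. *)
Definition same_rot (x y : cyclic_drawing * drawing_vertex) : bool :=
  let: (w, (k, v)) := x in
  let: (w', (k', v')) := y in
  [exists j : 'I_(size w),
     [&& w' == rot j w, k == (k' + j) %% size w & v' == v]].

Definition same_graph n : rel (drawing n) :=
  fun x y => same_rot (val x) (val y).

Lemma same_graph_equiv n : equiv_class_of (@same_graph n).
Proof.
have szP (x : drawing n) : 0 < size (val x).1 /\ (val x).2.1 < size (val x).1.
  case: x => [[w [k v]] /=] /and4P[-> _ _] /andP[/= -> _] //.
have refl : reflexive (@same_graph n).
  move=> x; have := szP x; rewrite /same_graph.
  case: (val x) => w [k v] /= [w0 kw]; apply/existsP.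
  by exists (Ordinal w0); rewrite /= rot0 addn0 modn_small ?eqxx.
have sym1 x y : @same_graph n x y -> same_graph y x.
  have := szP x; have := szP y; rewrite /same_graph.
  case: (val x) (val y) => w [k v] [w' [k' v']] /= [w'0 kw'] [w0 kw].
  move=> /existsP[[j jw] /and3P[/= /eqP ew /eqP ek /eqP ->]].
  apply/existsP; have sw : size w' = size w by rewrite ew size_rot.
  have jb : (size w - j) %% size w < size w' by rewrite sw ltn_mod.
  exists (Ordinal jb); rewrite /= eqxx sw andbT; apply/andP; split.
    rewrite ew; case: j jw {ek ew jb} => [|j] jw.
      by rewrite subn0 modnn !rot0.
    rewrite modn_small ?ltn_subrL ?w0 //.
    by rewrite -{1}(rotK j.+1 w) /rotr size_rot.
  rewrite ek modnDm -addnA subnKC ?(ltnW jw) // modnDr.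
  by rewrite modn_small // -sw.
split=> //; first by move=> x y; apply/idP/idP; exact: sym1.
move=> y x z; have := szP x; have := szP y; have := szP z.
rewrite /same_graph.
case: (val x) (val y) (val z) => w [k v] [w' [k' v']] [w2 [k2 v2]] /=.
move=> [w20 kw2] [w'0 kw'] [w0 kw].
move=> /existsP[[j jw] /and3P[/= /eqP ew /eqP ek /eqP ->]].
move=> /existsP[[i iw] /and3P[/= /eqP ew2 /eqP ek2 /eqP ->]].
have sw : size w' = size w by rewrite ew size_rot.
have ijw : (i + j) %% size w < size w by rewrite ltn_mod.
apply/existsP; exists (Ordinal ijw); rewrite /= eqxx andbT; apply/andP; split.
  rewrite ew2 ew; apply/eqP; rewrite rot_add_mod -?sw ?(ltnW iw) //; last first.
    by rewrite sw ltnW.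
  case: leqP; rewrite sw => h.
    move: h; rewrite leq_eqVlt => /orP[/eqP->|h]; last by rewrite modn_small.
    by rewrite modnn rot_size rot0.
  have sij : (i + j - size w) + size w = i + j by rewrite subnK // ltnW.
  rewrite -[in RHS]sij modnDr modn_small //.
  rewrite -(ltn_add2r (size w)) sij.
  by rewrite -addnS leq_add // -sw ltnW.
by rewrite ek ek2 sw modnDml modnDmr addnA.
Qed.

Canonical same_graph_rel n := EquivRelPack (same_graph_equiv n).

Definition calB (n : nat) : Type := {eq_quot (same_graph_rel n)}%qT.

(* Main.v *)
Require Import Defs.
From mathcomp Require Import all_boot generic_quotient.
From mathcomp Require Import zify.

(** A marked vertex [s] of depth [p] cuts a tree into a sequence of [p] pairs of
trees and one more tree.  Each strict ancestor [x] of [s] gives a pair: the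
children of [x] on the left of the path to [s], and those on its right, each
hung under a copy of [x]; the subtree rooted at [s] is what remains.  This loses
nothing ([spineK], [plugK]), and such a pair counts as many vertices as the same
pair attached to one vertex of a cycle.  So trees and unicyclic graphs are built
from the same bricks: with [T] and [P] the generating functions of trees and of
pairs, where [P = T^2 / z] and [T = z + T^2 = z + z P], one finds

  [A = \sum_(p >= 1) (2 p - 1) T P^p = T P (1 + P) / (1 - P)^2]
  [B = P (1 + P) / (1 - P) * P / (1 - P^2) = P^2 / (1 - P)^2]

for the triples and for the graphs: in [B], the cycle vertex carrying the mark
is numbered 0, its pair of trees together with the mark is counted by
[P + 2 P^2 / (1 - P)], according as the mark is the cycle vertex itself or lies
in one of the two trees, and the rest of the cycle is a sequence of odd length.
The two series agree because [T (1 + P) = P].  The common value [P^2 / (1 - P)^2]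
counts the cuts, that is, the sequences of pairs with a place where they are
split into two nonempty parts.  The proof turns these identities into
bijections from both sides to cuts.

For triples ([calA_cut_bijection]), [T + T P = P] reads: a pair is either [u]
with a second tree reduced to its root, or consists of a pair with [u] added as
first child of the root of its second tree.  The values [i <= p] use the first
form and the [p - 1] others use the second.

For graphs ([cut_calB_bijection]), the tree containing the mark is opened along
its spine, which is put in front of the cycle.  The length of the rest of the
cycle being odd, the parity of the cut position is free to record the face
containing the mark. *)

Set Implicit Arguments.
Unset Strict Implicit.
Unset Printing Implicit Defensive.

(** * Trees with a marked vertex as sequences of pairs of trees *)

Notation leaf := (Node [::]).

(** The subtree at [s], preceded by one pair for each strict ancestor of [s].
The two sides of the path at such an ancestor are made into trees so that the
result has the type of a cyclic drawing. *)
Fixpoint spine (t : tree) (s : address) : cyclic_drawing * tree :=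
  if s is i :: s' then
    let: (w, u) := spine (nth leaf (children t) i) s' in
    ((Node (take i (children t)), Node (drop i.+1 (children t))) :: w, u)
  else ([::], t).

Fixpoint plug (w : cyclic_drawing) (u : tree) : tree :=
  if w is (a, b) :: w' then Node (children a ++ plug w' u :: children b) else u.

(** The path goes through the child that follows those on the left of the path,
so the left components of the pairs determine the address. *)
Definition spine_address (w : cyclic_drawing) : address :=
  [seq size (children p.1) | p <- w].

Lemma spineK t s : is_vertex t s ->
  plug (spine t s).1 (spine t s).2 = t /\ spine_address (spine t s).1 = s.
Proof.
elim: s t => [|i s IH] [ts] //= /andP[lti /IH].
case: (spine _ s) => w u /= [-> ->]; split; last by rewrite size_take lti.
by rewrite -drop_nth // cat_take_drop.
Qed.

Lemma plugK w u : spine (plug w u) (spine_address w) = (w, u).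
Proof.
elim: w => [//|[[as_] [bs]] w IH] /=.
rewrite nth_cat ltnn subnn /= IH take_size_cat // -cat_rcons drop_size_cat //.
by rewrite size_rcons.
Qed.

Lemma is_vertex_plug w u : is_vertex (plug w u) (spine_address w).
Proof.
elim: w => [//|[[as_] [bs]] w IH] /=.
by rewrite nth_cat ltnn subnn /= IH size_cat /= addnS ltnS leq_addr.
Qed.

Lemma size_spine t s : size (spine t s).1 = size s.
Proof.
elim: s t => [|i s IH] t //=; move: (IH (nth leaf (children t) i)).
by case: (spine _ s) => w u /= ->.
Qed.

(** The predecessor accounts for the identification of the two roots. *)
Lemma drawing_nb_vertices_cons a b w :
  drawing_nb_vertices ((a, b) :: w) =
  (nb_vertices a + nb_vertices b).-1 + drawing_nb_vertices w.
Proof.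
rewrite /drawing_nb_vertices big_cons /=; congr (_ + _).
by case: a b => [?] [?] /=; rewrite add1n addSn addnS.
Qed.

Lemma drawing_nb_vertices_cat w1 w2 :
  drawing_nb_vertices (w1 ++ w2) =
  drawing_nb_vertices w1 + drawing_nb_vertices w2.
Proof. by rewrite /drawing_nb_vertices big_cat. Qed.

Lemma drawing_nb_vertices_rot k w :
  drawing_nb_vertices (rot k w) = drawing_nb_vertices w.
Proof. by apply: perm_big; rewrite perm_rot. Qed.

(** An ancestor is counted once, as are the two identified roots of its pair;
this is why the spine of a tree can be merged with a cycle. *)
Lemma nb_vertices_plug w u :
  nb_vertices (plug w u) = drawing_nb_vertices w + nb_vertices u.
Proof.
elim: w => [|[a b] w IH]; first by rewrite /drawing_nb_vertices big_nil.
rewrite drawing_nb_vertices_cons /= map_cat sumn_cat /= IH.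
by case: a b => [as_] [bs] /=; lia.
Qed.

(** Maps on the raw data suffice, provided that they preserve and are mutually
inverse on the constrained data; this keeps the constructions free of proofs. *)
Lemma sig_bijection (S T : Type) (P : pred S) (Q : pred T)
    (f : S -> T) (g : T -> S) :
    (forall x, P x -> Q (f x)) -> (forall y, Q y -> P (g y)) ->
    (forall x, P x -> g (f x) = x) -> (forall y, Q y -> f (g y) = y) ->
  exists F : {x | P x} -> {y | Q y}, bijective F.
Proof.
move=> fP gP fK gK.
exists (fun x => exist _ (f (val x)) (fP _ (valP x))).
exists (fun y => exist _ (g (val y)) (gP _ (valP y))).
  by move=> [x Px]; apply: val_inj; exact: fK.
by move=> [y Qy]; apply: val_inj; exact: gK.
Qed.

(** * Cuts of sequences of pairs *)

(** A sequence of pairs of trees of any length, with a position [x.2] where it is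
split into two nonempty parts. *)
Definition in_cut (n : nat) (x : cyclic_drawing * nat) : bool :=
  (drawing_nb_vertices x.1 == n) && (0 < x.2 < size x.1).

Definition cut (n : nat) : Type := {x : cyclic_drawing * nat | in_cut n x}.

(** * Trees and cuts *)

(** A spine of length [p] gives a cut of length [p + 1] with [i] between 1 and
[p], or a cut of length [p] with [i - p] between 1 and [p - 1].  The second tree
of the first pair is a leaf exactly in the first case, which makes the map
reversible. *)
Definition cut_of_calA (x : tree * address * nat) : cyclic_drawing * nat :=
  let: (A, s, i) := x in
  let: (w, u) := spine A s in
  if i <= size s then ((u, leaf) :: w, i)
  else if w is (a, b) :: w' then
    ((a, Node (u :: children b)) :: w', i - size s)
  else ([::], 0).

Definition calA_of_cut (x : cyclic_drawing * nat) : tree * address * nat :=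
  let: (w, j) := x in
  if w is (a, b) :: w' then
    if children b is u :: bs then
      let w1 := (a, Node bs) :: w' in
      (plug w1 u, spine_address w1, j + size w1)
    else (plug w' a, spine_address w', j)
  else (leaf, [::], 0).

Lemma calA_cut_bijection n : exists f : calA n -> cut n, bijective f.
Proof.
apply: (sig_bijection (f := cut_of_calA) (g := calA_of_cut)).
- move=> [[A s] i] /and4P[/eqP nA /spineK[eA es] _ /andP[i0 ile]].
  move: (size_spine A s) eA es ile => /=; case: (spine A s) => w u /= sw eA es.
  rewrite -nA -eA nb_vertices_plug /depth => ile.
  case: leqP => [les|lts].
    rewrite /in_cut drawing_nb_vertices_cons /= addn1 /= addnC eqxx i0 /=.
    by rewrite sw.
  case: w sw ile {eA es nA} => [|[a b] w] /= sw ile.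
    by rewrite -sw in lts ile; case: i ile lts {i0}.
  rewrite /in_cut /= subn_gt0 lts; apply/andP; split.
    by rewrite !drawing_nb_vertices_cons; case: a b => [as_] [bs] /=; lia.
  by lia.
- move=> [[|[a [[|u bs]]] w] j] /andP[/eqP /= <- /andP[/= j0 jw]] //.
    rewrite nb_vertices_plug is_vertex_plug j0 drawing_nb_vertices_cons /=.
    rewrite addn1 /= addnC eqxx /= /depth size_map.
    by case: w jw => [|p w] /= jw; lia.
  have /= -> := nb_vertices_plug ((a, Node bs) :: w) u.
  have /= -> := is_vertex_plug ((a, Node bs) :: w) u.
  rewrite !drawing_nb_vertices_cons /depth /= size_map.
  by case: a => [as_] /=; lia.
- move=> [[A s] i] /and4P[_ /spineK[eA es] _ /andP[i0 ile]].
  move: (size_spine A s) eA es => /=; case: (spine A s) => w u /= sw eA es.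
  case: leqP => [les|lts] /=; first by rewrite eA es.
  case: w sw eA es => [|[a b] w] /= sw eA es.
    by move: ile lts; rewrite /depth -sw /=; case: i i0.
  by rewrite eA es sw subnK // ltnW.
- move=> [[|[a [[|u bs]]] w] j] /andP[_ /andP[/= j0 jw]] //.
    by rewrite plugK size_map -ltnS jw.
  have /= -> := plugK ((a, Node bs) :: w) u.
  by rewrite size_map ifN ?addnK //= -ltnNge; lia.
Qed.

(** * Plane graphs and cuts *)

Definition side (inner : bool) (p : tree * tree) : tree :=
  if inner then p.1 else p.2.

Definition graft (inner : bool) (p : tree * tree) (t : tree) : tree * tree :=
  if inner then (t, p.2) else (p.1, t).

(** The marked tree is replaced by the subtree at the mark and its spine is put
in front.  A mark on the cycle vertex is read as the root of the inner tree.
In a cycle of even length [suf] has odd size, so the position is odd for an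
inner mark and even for an outer one. *)
Definition open_cycle (w : cyclic_drawing) (v : option (bool * address)) :
    cyclic_drawing * nat :=
  if w is p :: suf then
    let: (inner, s) := odflt (true, [::]) v in
    let: (pre, t) := spine (side inner p) s in
    (pre ++ graft inner p t :: suf, size suf + ~~ inner)
  else ([::], 0).

(** Inverse of [open_cycle]: [pre] becomes the spine of a tree in the face told by
[inner].  If [pre] is empty the mark is on the cycle vertex. *)
Definition close_cycle (inner : bool) (pre : cyclic_drawing) (p : tree * tree)
    (suf : cyclic_drawing) : cyclic_drawing * drawing_vertex :=
  (graft inner p (plug pre (side inner p)) :: suf,
   (0, if pre is [::] then None else Some (inner, spine_address pre))).

(** Among [j] and [j - 1], [c] is the odd one: it is the number of cycle vertices
other than the marked one. *)
Definition drawing_of_cut (x : cyclic_drawing * nat) :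
    cyclic_drawing * drawing_vertex :=
  let: (w, j) := x in
  let c := if odd j then j else j.-1 in
  let h := size w - c.+1 in
  close_cycle (odd j) (take h w) (nth (leaf, leaf) w h) (drop h.+1 w).

Arguments drawing_of_cut : simpl never.

Definition cut_of_drawing (x : cyclic_drawing * drawing_vertex) :
    cyclic_drawing * nat :=
  let: (w, (k, v)) := x in open_cycle (rot k w) v.

Lemma side_graft inner p t : side inner (graft inner p t) = t.
Proof. by case: inner. Qed.

Lemma graftK inner p t u : graft inner (graft inner p t) u = graft inner p u.
Proof. by case: inner. Qed.

Lemma graft_side inner p : graft inner p (side inner p) = p.
Proof. by case: p; case: inner. Qed.

(** Additive form, without subtraction, of the change of weight when one tree of a
pair is replaced. *)
Lemma nb_vertices_graft inner p t w :
  drawing_nb_vertices (graft inner p t :: w) + nb_vertices (side inner p) =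
  drawing_nb_vertices (p :: w) + nb_vertices t.
Proof.
case: p t => [[a] [b]] [t]; case: inner;
  by rewrite !drawing_nb_vertices_cons /=; lia.
Qed.

(** If [j] is even, [j < size w] leaves at least one item for [pre]: an outer mark
is never a root. *)
Lemma cutP w j : 0 < j < size w ->
  exists inner (pre : cyclic_drawing) p suf,
    [/\ w = pre ++ p :: suf, j = size suf + ~~ inner,
        odd (size suf) & inner || (pre != [::])].
Proof.
move=> jw; pose h := size w - (if odd j then j else j.-1).+1.
have hw : h < size w by rewrite /h; lia.
exists (odd j), (take h w), (nth (leaf, leaf) w h), (drop h.+1 w).
rewrite size_drop -drop_nth // cat_take_drop -size_eq0 size_take hw /h.
case: ifP => oj /=; split=> //=; lia.
Qed.

Lemma drawing_of_cutE inner pre p suf : odd (size suf) ->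
  drawing_of_cut (pre ++ p :: suf, size suf + ~~ inner) =
  close_cycle inner pre p suf.
Proof.
move=> os; rewrite /drawing_of_cut oddD os oddb size_cat /= negbK.
have -> : size pre + (size suf).+1 -
    (if inner then size suf + ~~ inner else (size suf + ~~ inner).-1).+1 =
    size pre by case: inner => /=; lia.
rewrite take_size_cat // nth_cat ltnn subnn /= -cat_rcons drop_size_cat //.
by rewrite size_rcons.
Qed.

Lemma open_close_cycle inner pre p suf : inner || (pre != [::]) ->
  open_cycle (close_cycle inner pre p suf).1 (close_cycle inner pre p suf).2.2 =
  (pre ++ p :: suf, size suf + ~~ inner).
Proof.
case: pre => [|q pre] /=; first by case: inner p => [[]|].
move=> _; rewrite side_graft.
have /= -> := plugK (q :: pre) (side inner p).
by rewrite graftK graft_side.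
Qed.

Lemma open_cycleK w v : 0 < size w -> ~~ odd (size w) ->
  is_drawing_vertex w (0, v) -> drawing_of_cut (open_cycle w v) = (w, (0, v)).
Proof.
case: w => [//|p suf] _ /=; rewrite negbK => os.
rewrite /is_drawing_vertex /= => vP.
set m := odflt _ v; have mP : is_vertex (side m.1 p) m.2.
  by rewrite /m; case: v vP {m} => [[[] s]|] //= /andP[].
have vE : v = if m.2 == [::] then None else Some m.
  by rewrite /m; case: v vP {m mP} => [[i s]|] //= /andP[/negPf->].
move: m mP vE {vP} => [inner s] /= mP ->; have [] := spineK mP.
have := size_spine (side inner p) s.
case: (spine _ _) => pre t /= sz eA es.
rewrite drawing_of_cutE // /close_cycle side_graft graftK eA graft_side -es.
by case: pre {sz eA es}.
Qed.

Lemma rot_add_modn (T : Type) (k j : nat) (w : seq T) :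
  k < size w -> j < size w -> rot ((k + j) %% size w) w = rot k (rot j w).
Proof.
move=> kw jw; rewrite rot_add_mod ?(ltnW kw) ?(ltnW jw) //.
case: leqP => [|h].
  rewrite leq_eqVlt => /orP[/eqP->|h]; last by rewrite modn_small.
  by rewrite modnn rot_size rot0.
rewrite -[in LHS](subnK (ltnW h)) modnDr modn_small //.
by rewrite ltn_subLR ?(ltnW h) //; lia.
Qed.

(** Numbering the cycle from the vertex that carries the mark removes the choice of
the starting point.  This makes the opening well defined on graphs, even for
those whose cycle has a rotational symmetry. *)
Lemma cut_of_drawing_same_rot n (x y : drawing n) :
  same_graph x y -> cut_of_drawing (val x) = cut_of_drawing (val y).
Proof.
case: x y => [[w [k v]] xP] [[w' [k' v']] yP] /=; rewrite /same_graph /=.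
move=> /existsP[[j jw] /= /and3P[/eqP w'E /eqP-> /eqP->]].
have /andP[k'w _] : is_drawing_vertex w' (k', v') by case/and4P: yP.
by rewrite w'E rot_add_modn //; rewrite w'E size_rot in k'w.
Qed.

Lemma cut_of_drawing_in_cut n x : in_drawing n x -> in_cut n (cut_of_drawing x).
Proof.
case: x => w [k v] /and4P[w0 ow /eqP nw /andP[/= kw vP]].
rewrite -nw -(drawing_nb_vertices_rot k).
have : drop k w = nth (leaf, leaf) w k :: drop k.+1 w by exact: drop_nth.
rewrite /rot => ->; rewrite /=.
set p := nth _ w k in vP *; set suf := drop k.+1 w ++ take k w.
have os : odd (size suf).
  by rewrite /suf size_cat size_take size_drop kw; lia.
set m := odflt _ v; have mP : is_vertex (side m.1 p) m.2.
  by rewrite /m; case: v vP {m} => [[[] s]|] //= /andP[].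
(* An outer mark is not a root, so its spine makes room for the shift by one. *)
have mN : m.1 || (0 < size m.2).
  by rewrite /m; case: v vP {m mP} => [[[] [|? ?]]|].
case: m mP mN => inner s /= mP mN; have [] := spineK mP.
have := size_spine (side inner p) s.
case: (spine _ _) => pre t /= sz eA es; rewrite /in_cut /=.
apply/andP; split; last by rewrite size_cat /= sz; lia.
have := nb_vertices_graft inner p t suf; rewrite -eA nb_vertices_plug.
by rewrite drawing_nb_vertices_cat; lia.
Qed.

Lemma drawing_of_cut_in_drawing n x :
  in_cut n x -> in_drawing n (drawing_of_cut x).
Proof.
case: x => w j /andP[/eqP <- jw].
have [inner [pre [p [suf [-> -> os ip]]]]] := @cutP w j jw.
rewrite drawing_of_cutE // /in_drawing /close_cycle /= os /=.
apply/andP; split.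
  have := nb_vertices_graft inner p (plug pre (side inner p)) suf.
  by rewrite nb_vertices_plug drawing_nb_vertices_cat; lia.
rewrite /is_drawing_vertex /=; case: pre ip => [|q pre] //= _.
have := is_vertex_plug (q :: pre) (side inner p).
by case: inner.
Qed.

Lemma drawing_of_cutK n x : in_cut n x -> cut_of_drawing (drawing_of_cut x) = x.
Proof.
case: x => w j /andP[_ jw].
have [inner [pre [p [suf [-> -> os ip]]]]] := @cutP w j jw.
rewrite drawing_of_cutE // -(open_close_cycle p suf ip).
by rewrite /cut_of_drawing /close_cycle rot0.
Qed.

(** A drawing is recovered only up to rotation, since [cut_of_drawing] forgets
which cycle vertex was numbered 0. *)
Lemma cut_of_drawingK n x :
  in_drawing n x -> same_rot x (drawing_of_cut (cut_of_drawing x)).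
Proof.
case: x => w [k v] /and4P[w0 ow _ /andP[/= kw vP]].
rewrite open_cycleK ?size_rot //; last first.
  rewrite /is_drawing_vertex /= size_rot w0 /=.
  by rewrite {1}/rot nth_cat size_drop subn_gt0 kw nth_drop addn0.
by apply/existsP; exists (Ordinal kw); rewrite /= !eqxx modn_small ?eqxx.
Qed.

Lemma cut_calB_bijection n : exists f : cut n -> calB n, bijective f.
Proof.
pose d_of (x : cut n) : drawing n :=
  exist (in_drawing n) _ (drawing_of_cut_in_drawing (valP x)).
pose c_of (d : drawing n) : cut n :=
  exist (in_cut n) _ (cut_of_drawing_in_cut (valP d)).
exists (fun x => \pi_(calB n) (d_of x))%qT, (fun b => c_of (repr b)) => [x|b].
  apply: val_inj; rewrite /= -[RHS](drawing_of_cutK (valP x)).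
  apply: (@cut_of_drawing_same_rot n _ (d_of x)).
  by apply/(@eqmodP _ (same_graph_rel n)); rewrite reprK.
rewrite -[RHS]reprK; apply/esym/(@eqmodP _ (same_graph_rel n)).
exact: cut_of_drawingK (valP (repr b)).
Qed.

Theorem proposition3p4 (n : nat) (hn : 0 < n) :
  exists f : calA n -> calB n, bijective f.
Proof.
have [f f_bij] := calA_cut_bijection n; have [g g_bij] := cut_calB_bijection n.
by exists (g \o f); exact: bij_comp.
Qed.
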